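(* Let $\sigma=\sigma_1\cdots\sigma_k$ be a Cayley permutation with $k\ge 2$. Let $\pi$ be a Cayley permutation and let $\gamma=\mathcal{R}(\mathcal{S}^{\sigma}(\pi))$. Then: (1) if $\sigma_1=\sigma_2$, then $P_\sigma(\pi)=\mathcal{R}(P_\sigma(\gamma))$; (2) if $P_\sigma(\pi)=\mathcal{R}(P_\sigma(\gamma))$, then $(\mathcal{R}\circ\mathcal{S}^{\sigma})^2(\pi)=\pi$.
   Context: A Cayley permutation is a finite word $\pi=\pi_1\cdots\pi_n$ over the positive integers such that every integer from $1$ to $\max(\pi)$ occurs at least once. A word contains a pattern $p=p_1\cdots p_k$ if it has a subsequence $x_{i_1}\cdots x_{i_k}$ with $x_{i_u}<x_{i_v}$ iff $p_u<p_v$ and $x_{i_u}=x_{i_v}$ iff $p_u=p_v$; otherwise it avoids $p$. For a word $w$, $\mathcal{R}(w)$ is its reverse. A $\sigma$-stack processes an input word from left to right with the following right-greedy algorithm: while the input is nonempty, if pushing the next input element onto the stack yields stack contents which, read from top to bottom, avoid $\sigma$, the element is pushed; otherwise the top element is popped and appended to the output. When the input is exhausted, the remaining elements are popped one by one. $\mathcal{S}^{\sigma}(\pi)$ denotes the output on input $\pi$. $P_\sigma(\pi)$ is the Dyck path (word in the steps $U=(1,1)$ and $D=(1,-1)$ starting at the origin, never going below the $x$-axis and ending on it) obtained by recording, in order, each push performed while processing $\pi$ with the $\sigma$-stack as a step $U$ and each pop as a step $D$. For a Dyck path $P$ of length $2n$, $\mathcal{R}(P)$ denotes its reflection in the vertical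 line $x=n$ (equivalently, reverse the word of steps and exchange $U$ and $D$). *)

(* Defs.v *)
From mathcomp Require Import all_boot.

Set Implicit Arguments.
Unset Strict Implicit.
Unset Printing Implicit Defensive.

(* A word is a [seq nat]. The empty word, of maximum 0, is a Cayley
   permutation. *)
Definition cayley (w : seq nat) : Prop :=
  forall i : nat, (i \in w) = (1 <= i <= \max_(x <- w) x).

Definition order_iso (s p : seq nat) : bool :=
  (size s == size p) &&
  [forall u : 'I_(size p), forall v : 'I_(size p),
     ((nth 0 s u < nth 0 s v) == (nth 0 p u < nth 0 p v))
     && ((nth 0 s u == nth 0 s v) == (nth 0 p u == nth 0 p v))].

(* The subsequences of [w] are the [mask m w]. *)
Definition contains (w p : seq nat) : bool :=
  [exists m : (size w).-tuple bool, order_iso (mask m w) p].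

Definition avoids (w p : seq nat) : bool := ~~ contains w p.

Inductive updown : Set := U | D.

Definition flip (s : updown) : updown :=
  match s with U => D | D => U end.

Definition reflect_path (P : seq updown) : seq updown := rev (map flip P).

(* [stack] is listed from top to bottom, [output] and [steps] in chronological
   order. *)
Record config := Config {
  input : seq nat;
  stack : seq nat;
  output : seq nat;
  steps : seq updown
}.

Definition pop (c : config) : config :=
  match stack c with
  | [::] => c
  | y :: s => Config (input c) s (rcons (output c) y) (rcons (steps c) D)
  end.

Definition stack_step (sigma : seq nat) (c : config) : config :=
  match input c with
  | [::] => pop c
  | x :: w =>
      if avoids (x :: stack c) sigma
      then Config w (x :: stack c) (output c) (rcons (steps c) U)
      else pop c
  end.

(* Each entry is pushed once and popped once, so the algorithm stops after
   [2 * size w] operations. This uses [2 <= size sigma], which makes a push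
   onto the empty stack always legal. *)
Definition run (sigma w : seq nat) : config :=
  iter (2 * size w) (stack_step sigma) (Config w [::] [::] [::]).

Definition stack_map (sigma w : seq nat) : seq nat := output (run sigma w).

Definition dyck_path (sigma w : seq nat) : seq updown := steps (run sigma w).

(* Main.v *)
(** Reading a run backwards turns each pop into a push of the reversed output and
    each push into a pop, so the reflected path applied to [gamma] rebuilds [rev pi];
    this gives (2), an output being determined by the input and the path.

    For (1), the backward run has to be greedy. Its pushes are legal because the
    stack always avoids [sigma]. For its pops, let [y] be the last output when [x]
    is pushed in the forward run: [y] was popped from some [y :: t] because [z :: y :: t]
    contained [sigma], [z] being the next input. Since [y :: t] and [z :: t] both avoid
    [sigma], an occurrence starts with [z] and [y], and [sigma_1 = sigma_2] forces [z = y].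
    As [z :: t] is still at the bottom of the stack, putting [y] on top of it
    creates an occurrence of [sigma]. *)
Require Import Defs.
From mathcomp Require Import all_boot.
From mathcomp Require Import zify.

Set Implicit Arguments.
Unset Strict Implicit.
Unset Printing Implicit Defensive.

(** * Pattern containment *)

Lemma containsP (w p : seq nat) :
  reflect (exists2 s, subseq s w & order_iso s p) (contains w p).
Proof.
apply: (iffP existsP) => [[m iso_m] | [s /subseqP[m size_m ->] iso_s]].
  by exists (mask m w) => //; apply: mask_subseq.
by exists (tcast size_m (in_tuple m)); rewrite val_tcast.
Qed.

Lemma contains_subseq (w1 w2 p : seq nat) :
  subseq w1 w2 -> contains w1 p -> contains w2 p.
Proof.
move=> sub12 /containsP[s sub1 iso_s]; apply/containsP.
by exists s => //; apply: subseq_trans sub12.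
Qed.

Lemma avoids_subseq (w1 w2 p : seq nat) :
  subseq w1 w2 -> avoids w2 p -> avoids w1 p.
Proof. by move=> sub12; apply/contra/contains_subseq. Qed.

Lemma avoids_short (w p : seq nat) : size w < size p -> avoids w p.
Proof.
move=> lt_wp; apply/negP => /containsP[s /size_subseq le_sw /andP[/eqP sz _]].
by move: lt_wp; rewrite -sz ltnNge le_sw.
Qed.

Lemma contains_swap (x y : nat) (t p : seq nat) :
    2 <= size p -> nth 0 p 0 = nth 0 p 1 ->
    avoids (y :: t) p -> avoids (x :: t) p ->
  contains (x :: y :: t) p -> contains (y :: x :: t) p.
Proof.
move=> p_ge2 p01 av_y av_x c_xy.
case/containsP: c_xy => s sub_s iso_s; apply/containsP; exists s => //.
have /andP[/eqP size_s /forallP nth_s] := iso_s.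
case: s => [|a [|b s]] in sub_s iso_s size_s nth_s *;
  [by move: p_ge2; rewrite -size_s.. |].
have lt0p : 0 < size p by apply: ltnW.
have /forallP/(_ (Ordinal p_ge2))/= := nth_s (Ordinal lt0p).
rewrite p01 !eqxx eqb_id => /andP[_ /eqP ab]; subst b.
(* An occurrence not starting with [x] lies in [y :: t]. One starting with [x], [x] where [x != y]
   must skip [y], so it lies in [x :: t]. Only [x = y] survives. *)
move: sub_s => /=; case: (eqVneq a x) => [ax | _ sub_s]; last first.
  by case/negP: av_y; apply/containsP; exists [:: a, a & s].
subst a; case: (eqVneq x y) => [-> | _ sub_s]; first by rewrite eqxx.
by case/negP: av_x; apply/containsP; exists [:: x, x & s] => //=; rewrite eqxx.
Qed.

(** * Prescribed moves and their reversal *)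

Definition legal (d : updown) (c : config) : bool :=
  match d with U => input c != [::] | D => stack c != [::] end.

(** The move is dictated rather than chosen by testing [sigma], so that a recorded path can be
    replayed forwards or backwards. *)
Definition act (c : config) (d : updown) : config :=
  match d, input c with
  | U, x :: w => Config w (x :: stack c) (output c) (rcons (steps c) U)
  | U, [::] => c
  | D, _ => pop c
  end.

(** Each pending input entry still costs a push and a pop, each stacked entry a pop. *)
Definition remaining (c : config) : nat := 2 * size (input c) + size (stack c).

Definition weight (c : config) : nat :=
  size (input c) + size (stack c) + size (output c).

(* The state seen when the run is read backwards; [P] is the path of the backward
   run so far. *)
Definition mirror (P : seq updown) (c : config) : config :=
  Config (rev (output c)) (stack c) (rev (input c)) P.

Lemma steps_act (c : config) (d : updown) :
  legal d c -> steps (act c d) = rcons (steps c) d.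
Proof. by case: d c => [] [[|x i] [|y s] o P]. Qed.

Lemma remaining_act (c : config) (d : updown) :
  legal d c -> (remaining (act c d)).+1 = remaining c.
Proof. by case: d c => [] [[|x i] [|y s] o P] //= _; rewrite /remaining /=; lia. Qed.

Lemma weight_act (c : config) (d : updown) :
  legal d c -> weight (act c d) = weight c.
Proof.
by case: d c => [] [[|x i] [|y s] o P] //= _;
  rewrite /weight /= ?size_rcons; lia.
Qed.

Lemma mirror_act (P : seq updown) (c : config) (d : updown) :
  legal d c ->
  act (mirror P (act c d)) (flip d) = mirror (rcons P (flip d)) c.
Proof.
by case: d c => [] [[|x i] [|y s] o Q] //= _;
  rewrite /mirror /act /pop /= ?rev_cons ?rev_rcons.
Qed.

Lemma reflect_path_rcons (P : seq updown) (d : updown) :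
  reflect_path (rcons P d) = flip d :: reflect_path P.
Proof. by rewrite /reflect_path map_rcons rev_rcons. Qed.

Lemma reflect_pathK : involutive reflect_path.
Proof.
move=> P; rewrite /reflect_path map_rev revK -map_comp -[RHS]map_id.
by apply: eq_map => -[].
Qed.

(** * Greedy runs *)

Section Run.

Variable sigma : seq nat.
Hypothesis sigma_ge2 : 2 <= size sigma.

(** The condition in [StepPop] is vacuous once the input is exhausted, so this case covers both
    forced pops and the final emptying. *)
Variant stack_step_spec (c : config) : config -> Prop :=
| StepPush x w of input c = x :: w & avoids (x :: stack c) sigma :
    stack_step_spec c (act c U)
| StepPop y s of stack c = y :: s
    & (forall x w, input c = x :: w -> contains (x :: stack c) sigma) :
    stack_step_spec c (act c D).

Lemma stack_stepP (c : config) :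
  0 < remaining c -> stack_step_spec c (stack_step sigma c).
Proof.
rewrite /remaining /stack_step; case: c => [[|x i] s o P] /=.
  by case: s => [|y s] // _; apply: (@StepPop _ y s).
case: ifP => [av _ | nav _].
  exact: (@StepPush (Config (x :: i) s o P) x i).
case: s nav => [|y s] nav; first by rewrite avoids_short in nav.
apply: (@StepPop (Config (x :: i) (y :: s) o P) y s) => // _ _ [<- _].
exact: negbFE.
Qed.

Lemma stack_step_act (c : config) :
  0 < remaining c -> exists2 d, legal d c & stack_step sigma c = act c d.
Proof.
by case/stack_stepP=> [x w def_in _ | y s def_st _]; [exists U | exists D];
  rewrite //= ?def_in ?def_st.
Qed.

Section Iterate.

Variable w : seq nat.

Let state (n : nat) : config := iter n (stack_step sigma) (Config w [::] [::] [::]).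

Lemma remaining_iter (n : nat) :
  n <= 2 * size w -> n + remaining (state n) = 2 * size w.
Proof.
elim: n => [_ | n IHn lt_n]; first by rewrite /remaining /= addn0.
have rem_n := IHn (ltnW lt_n).
have [|d leg_d def_n] := @stack_step_act (state n); first by lia.
by have := remaining_act leg_d; rewrite /state /= -/(state n) def_n; lia.
Qed.

Lemma iter_act (n : nat) : n < 2 * size w ->
  exists2 d, legal d (state n) & state n.+1 = act (state n) d.
Proof.
by move=> lt_n; apply: stack_step_act; have := remaining_iter (ltnW lt_n); lia.
Qed.

Lemma weight_iter (n : nat) : n <= 2 * size w -> weight (state n) = size w.
Proof.
elim: n => [_ | n IHn lt_n]; first by rewrite /weight /= !addn0.
have [d leg_d ->] := iter_act lt_n.
by rewrite weight_act // IHn // ltnW.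
Qed.

Lemma run_empty : input (run sigma w) = [::] /\ stack (run sigma w) = [::].
Proof.
have := remaining_iter (leqnn _); rewrite /state -/(run sigma w) /remaining.
by case: (input _) (stack _) => [|x i] [|y s] /=; first (by []); lia.
Qed.

Lemma size_stack_map : size (stack_map sigma w) = size w.
Proof.
have := weight_iter (leqnn _); rewrite /state -/(run sigma w) /weight.
by have [-> ->] := run_empty.
Qed.

Lemma mirror_run :
  mirror [::] (run sigma w) = Config (rev (stack_map sigma w)) [::] [::] [::].
Proof. by rewrite /mirror; have [-> ->] := run_empty. Qed.

Lemma foldl_act_iter (n : nat) : n <= 2 * size w ->
  state n = foldl act (state 0) (steps (state n)).
Proof.
elim: n => [// | n IHn lt_n]; have [d leg_d ->] := iter_act lt_n.
by rewrite steps_act // foldl_rcons -IHn // ltnW.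
Qed.

(** The last forward move is undone first; the arbitrary prefix [P] absorbs it before the induction
    hypothesis applies. *)
Lemma foldl_act_mirror (n : nat) (P : seq updown) : n <= 2 * size w ->
  foldl act (mirror P (state n)) (reflect_path (steps (state n)))
    = mirror (P ++ reflect_path (steps (state n))) (state 0).
Proof.
elim: n P => [P _ | n IHn P lt_n]; first by rewrite /= cats0.
have [d leg_d ->] := iter_act lt_n.
rewrite steps_act // reflect_path_rcons /= mirror_act // IHn ?(ltnW lt_n) //.
by rewrite cat_rcons.
Qed.

(* The last output [y] cannot be put back on the stack, or else it has just been
   popped because of the next input [x]. *)
Definition blocked (c : config) : Prop :=
  forall o y, output c = rcons o y ->
    contains (y :: stack c) sigma \/
    forall x i, input c = x :: i ->
      contains (x :: y :: stack c) sigma && avoids (y :: stack c) sigma.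

Hypothesis sigma01 : nth 0 sigma 0 = nth 0 sigma 1.

(** This forces the backward run to pop [x] instead of pushing [y]. An occurrence in [y :: stack c]
    survives inserting [x] below [y]; otherwise [contains_swap] applies. *)
Lemma blocked_push (c : config) (x : nat) (i : seq nat) :
    input c = x :: i -> avoids (x :: stack c) sigma -> blocked c ->
  forall o y, output c = rcons o y -> contains (y :: x :: stack c) sigma.
Proof.
move=> def_i av_x blk o y def_o.
case: (blk o y def_o) => [c_y | /(_ x i def_i)/andP[c_xy av_y]].
  apply: contains_subseq c_y; apply: (@cat_subseq _ [:: y] _ [:: y]) => //.
  exact: subseq_cons.
exact: contains_swap.
Qed.

(** A push establishes the first alternative of [blocked], a pop the second. *)
Lemma iter_blocked (n : nat) : n <= 2 * size w ->
  avoids (stack (state n)) sigma /\ blocked (state n).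
Proof.
elim: n => [_ | n IHn lt_n].
  by split; [apply: avoids_short; apply: ltnW | case].
have [av_s blk] := IHn (ltnW lt_n).
have : 0 < remaining (state n) by have := remaining_iter (ltnW lt_n); lia.
rewrite [state n.+1]/=; rewrite -/(state n).
case/stack_stepP=> [x i def_i av_x | y s def_s c_x].
  rewrite /act def_i; split=> // o y def_o; left.
  exact: (blocked_push def_i av_x blk def_o).
rewrite /act /pop def_s; split=> /=.
  by apply: avoids_subseq av_s; rewrite def_s subseq_cons.
move=> o z /= /rcons_inj[_ <-]; right=> x i /c_x.
by rewrite -def_s av_s => ->.
Qed.

Lemma iter_mirror (n : nat) (P : seq updown) : n <= 2 * size w ->
  iter n (stack_step sigma) (mirror P (state n))
    = mirror (P ++ reflect_path (steps (state n))) (state 0).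
Proof.
elim: n P => [P _ | n IHn P lt_n]; first by rewrite /= cats0.
have [av_s blk] := iter_blocked (ltnW lt_n).
have : 0 < remaining (state n) by have := remaining_iter (ltnW lt_n); lia.
(* It suffices that the greedy rule, at the mirror of [state n.+1], chooses to undo the move [d]. *)
suff step_d d : legal d (state n) -> state n.+1 = act (state n) d ->
    stack_step sigma (mirror P (act (state n) d))
      = act (mirror P (act (state n) d)) (flip d) ->
  iter n.+1 (stack_step sigma) (mirror P (state n.+1))
    = mirror (P ++ reflect_path (steps (state n.+1))) (state 0).
  have def_n : state n.+1 = stack_step sigma (state n) by [].
  move=> rem_n; case: (stack_stepP rem_n) def_n => [x i def_i av_x | y s def_s _] def_n.
    apply: (step_d U) => //=; first by rewrite def_i.
    rewrite /act def_i /mirror /stack_step /=.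
    (* With no output yet, the mirrored input is empty and the machine pops anyway. *)
    case/lastP def_o: (output (state n)) => [|o y]; first by [].
    rewrite rev_rcons /avoids.
    by rewrite (blocked_push def_i av_x blk def_o).
  (* Pushing [y] back restores the stack of [state n], which avoids [sigma]. *)
  apply: (step_d D) => //=; first by rewrite def_s.
  by rewrite /act /pop def_s /mirror /stack_step /= rev_rcons -def_s av_s.
move=> leg_d -> step_d; rewrite iterSr step_d mirror_act // IHn ?(ltnW lt_n) //.
by rewrite steps_act // reflect_path_rcons cat_rcons.
Qed.

End Iterate.

Lemma dyck_path_reflect (w : seq nat) : nth 0 sigma 0 = nth 0 sigma 1 ->
  dyck_path sigma (rev (stack_map sigma w)) = reflect_path (dyck_path sigma w).
Proof.
move=> sigma01; rewrite {1}/dyck_path {1}/run size_rev size_stack_map.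
by rewrite -mirror_run iter_mirror.
Qed.

(** Replaying the reflected path from the mirror of the final state leads to the mirror of the
    initial one, whose output is [rev w]. *)
Lemma stack_map_reflect (w : seq nat) :
    dyck_path sigma (rev (stack_map sigma w)) = reflect_path (dyck_path sigma w) ->
  stack_map sigma (rev (stack_map sigma w)) = rev w.
Proof.
move=> path_eq; rewrite {1}/stack_map /run foldl_act_iter //.
rewrite -/(run _ _) -/(dyck_path _ _) path_eq /= -mirror_run.
by rewrite foldl_act_mirror.
Qed.

End Run.

Theorem theorem8 (sigma pi : seq nat) (hsigma : cayley sigma)
    (hk : 2 <= size sigma) (hpi : cayley pi) :
  let gamma := rev (stack_map sigma pi) in
  (nth 0 sigma 0 = nth 0 sigma 1 ->
     dyck_path sigma pi = reflect_path (dyck_path sigma gamma))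
  /\ (dyck_path sigma pi = reflect_path (dyck_path sigma gamma) ->
        iter 2 (rev \o stack_map sigma) pi = pi).
Proof.
move=> gamma; split=> [sigma01 | path_eq].
  by rewrite dyck_path_reflect // reflect_pathK.
by rewrite /= stack_map_reflect ?revK // path_eq reflect_pathK.
Qed.
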